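(* Let $G$ be a (finite, simple) plane graph with minimum degree five that contains no $\langle 5,5,5,5,\infty\rangle$-star, no vertex of degree $6$ and no vertex of degree $7$. Then $G$ has a minor $5$-star of weight at most $44$ and height at most $15$.
   Context: A plane graph is a graph embedded in the plane without edge crossings; $\deg(v)$ denotes the degree of $v$ in $G$. For integers (or $\infty$) $\kappa_1,\dots,\kappa_5$, a $\langle \kappa_1,\kappa_2,\kappa_3,\kappa_4,\kappa_5\rangle$-star in $G$ is a vertex $v$ of degree exactly $5$ together with its five neighbors $v_1,\dots,v_5$, listed in the cyclic order around $v$ given by the embedding (starting at some neighbor, in either orientation), such that $\deg(v_i)\le \kappa_i$ for $i=1,\dots,5$; the entry $\infty$ means no restriction. A minor $5$-star is a $5$-vertex together with its five neighbors. The weight of a subgraph $H$ is $\sum_{v\in V(H)}\deg_G(v)$, and its height is $\max_{v\in V(H)}\deg_G(v)$. *)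

(* Defs.v *)
From mathcomp Require Import all_boot.

Set Implicit Arguments.
Unset Strict Implicit.
Unset Printing Implicit Defensive.

(* A finite simple graph with a rotation system: [rotation v] lists the
   neighbours of [v] in their cyclic (say clockwise) order around [v]; the
   choice of the neighbour that comes first carries no information.  An
   embedding into an oriented surface is given, up to homeomorphism on each
   connected component, by such a system. *)
Record embedded_graph := EmbeddedGraph {
  vertex :> finType;
  adj : rel vertex;
  adj_sym : symmetric adj;
  adj_irr : irreflexive adj;
  rotation : vertex -> seq vertex;
  rotation_uniq : forall v, uniq (rotation v);
  mem_rotation : forall v u, (u \in rotation v) = adj v u
}.

Section EmbeddedGraph.
Variable G : embedded_graph.
Implicit Types (v : G) (A : {set G}).

Definition neighbours v : {set G} := [set u | adj v u].

Definition deg v : nat := #|neighbours v|.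

Definition min_degree_is (d : nat) : Prop :=
  (exists v, deg v = d) /\ (forall v, d <= deg v).

Definition edges : {set {set G}} :=
  [set [set d.1; d.2] | d : G * G & adj d.1 d.2].

(* Face tracing: having walked along the dart (u, v), leave v along the edge
   that follows vu in the rotation at v. *)
Definition face_step (d : G * G) : G * G :=
  (d.2, next (rotation d.2) d.1).

(* The faces of the surfaces carrying the components: one for each closed walk
   traced by [face_step] on darts, and, for an isolated vertex, which has no
   dart, the whole complement of that vertex in its sphere. *)
Definition num_faces : nat :=
  fcard face_step [pred d : G * G | adj d.1 d.2] + #|[set v | deg v == 0]|.

Definition num_components : nat := n_comp (@adj G) G.

(* Euler's formula V - E + F = 2C, where faces are counted separately for each
   of the C components.  As V - E + F <= 2 holds for each component, with
   equality exactly for the sphere, this says that every component is embedded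
   in the sphere, i.e. that [rotation] is the rotation system of a drawing of
   the graph in the plane without crossings.  (A drawing of the whole graph in
   one plane has F - C + 1 faces, whence V - E + (F - C + 1) = 1 + C.) *)
Definition plane : Prop :=
  #|G| + num_faces = #|edges| + 2 * num_components.

(* The lists of the neighbours of v in cyclic order, starting at any
   neighbour and in either orientation. *)
Definition cyclic_listing v (s : seq G) : Prop :=
  exists i, s = rot i (rotation v) \/ s = rot i (rev (rotation v)).

(* [None] stands for infinity. *)
Definition le_bound (n : nat) (k : option nat) : bool :=
  if k is Some m then n <= m else true.

Definition has_star (k1 k2 k3 k4 k5 : option nat) : Prop :=
  exists v v1 v2 v3 v4 v5,
    [/\ deg v = 5, cyclic_listing v [:: v1; v2; v3; v4; v5]
      & [/\ le_bound (deg v1) k1, le_bound (deg v2) k2, le_bound (deg v3) k3,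
            le_bound (deg v4) k4 & le_bound (deg v5) k5]].

Definition weight A : nat := \sum_(v in A) deg v.

Definition height A : nat := \max_(v in A) deg v.

(* A is the vertex set of a minor 5-star. *)
Definition minor_5star A : Prop :=
  exists2 v, deg v = 5 & A = v |: neighbours v.

End EmbeddedGraph.

(* Main.v *)
(** Discharging, in units of 1/80. Give every vertex v the charge deg v - 6 and
    every face f the charge 2|f| - 6; by Euler's formula the total is negative.
    A big vertex (degree at least 8) sends [share] to each side of each of its
    edges, redirecting to the third vertex of a triangle what would reach
    another big vertex, and a face that is not a triangle gives 40 to each of
    its corners. If no star is light, a 5-vertex falls short of the 80 units it
    needs only if all its faces are triangles and it has exactly two big
    neighbours, which are not consecutive, one of degree at most 9 and one of
    degree at least 16; it then lacks at most 10. Writing its neighbours in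
    cyclic order as x, a, y, b, c with x, y big, one of b, c receives at least
    100: the common neighbour t of b and c beyond the edge bc is either small,
    and then b has two consecutive big neighbours, or of degree at least 16,
    and then it joins whichever of x, y has degree at least 16. A 5-vertex
    receiving at least 100 can afford 10 for each needy neighbour, so in the end
    no 5-vertex has a negative charge, a contradiction. *)

Require Import Defs.
From mathcomp Require Import all_boot.
From mathcomp Require Import zify.

Set Implicit Arguments.
Unset Strict Implicit.
Unset Printing Implicit Defensive.

Lemma next_neq (T : eqType) (p : seq T) x :
  uniq p -> 1 < size p -> x \in p -> next p x != x.
Proof.
move=> Up p_gt1 /rot_to[i s def_p]; rewrite -(next_rot i Up).
move: Up p_gt1; rewrite -(rot_uniq i) -(size_rot i) {}def_p.
by case: s => [|y s] //= /andP[+ _] _; rewrite inE negb_or eqxx eq_sym => /andP[].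
Qed.

Lemma next_inj (T : eqType) (p : seq T) : uniq p -> injective (next p).
Proof. by move/prev_next/can_inj. Qed.

Lemma fcard_leq_sum (T : finType) (f : T -> T) (a : {pred T}) (w : T -> nat) k :
    injective f -> fclosed f a -> (forall x, w (f x) = w x) ->
    {in a, forall x, k <= order f x * w x} ->
  k * fcard f a <= \sum_(x in a) w x.
Proof.
move=> f_inj a_cl w_f k_le; have f_sym := fconnect_sym f_inj.
have w_root x y : fconnect f x y -> w y = w x.
  by case/connectP=> p; elim: p x => [|z p IHp] x /=
    => [_ ->|/andP[/eqP<- /IHp/[apply]->]].
rewrite (partition_big (froot f) (predI (froots f) a)) /=; last first.
  move=> x ax; apply/andP; split; first exact: roots_root.
  by rewrite -[X in is_true X](closed_connect a_cl (connect_root (frel f) x)).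
rewrite mulnC -sum_nat_const; apply: leq_sum => r /andP[/eqP r_root ar].
have {}ar : r \in a by [].
apply: leq_trans (k_le r ar) _; rewrite /order -sum_nat_const.
rewrite (eq_bigl [pred x | (x \in a) && (froot f x == r)]) => [|x /=].
  apply: leq_sum => x /andP[_ /eqP/esym xr].
  by rewrite (w_root r) // -(root_connect f_sym) r_root xr.
rewrite -[x \in fconnect f r]/(fconnect f r x) -(root_connect f_sym) r_root eq_sym.
case: eqP => [rx|]; last by rewrite andbF.
by rewrite andbT (closed_connect a_cl (connect_root _ x)) rx ar.
Qed.

Section Darts.
Variable G : embedded_graph.
Implicit Types (u v w x : G) (d : G * G).

Notation face_step := (@face_step G).

Definition darts : pred (G * G) := [pred d | adj d.1 d.2].

Lemma size_rotation v : size (rotation v) = deg v.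
Proof.
rewrite /deg -(card_uniqP (rotation_uniq v)); apply: eq_card => u.
by rewrite mem_rotation inE.
Qed.

Lemma face_step_inj : injective face_step.
Proof.
move=> [u v] [u' v'] []; rewrite /= => <- /(next_inj (rotation_uniq v)) <- //.
Qed.

Lemma face_step_dart d : darts (face_step d) = darts d.
Proof.
by rewrite /darts /= -!mem_rotation mem_next mem_rotation adj_sym mem_rotation.
Qed.

Lemma sum_darts (F : G -> G -> nat) :
  \sum_(d in darts) F d.1 d.2 = \sum_v \sum_(u <- rotation v) F u v.
Proof.
rewrite -(pair_big_dep xpredT (fun u v => adj u v) F) /=.
rewrite (exchange_big_dep xpredT) //=; apply: eq_bigr => v _.
rewrite big_uniq ?rotation_uniq //=; apply: eq_bigl => u.
by rewrite mem_rotation adj_sym.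
Qed.

Lemma card_darts : #|darts| = \sum_(v : G) deg v.
Proof.
rewrite -sum1_card (sum_darts (fun _ _ => 1)); apply: eq_bigr => v _.
by rewrite sum1_size size_rotation.
Qed.

Lemma card_darts_edges : #|darts| <= 2 * #|edges G|.
Proof.
rewrite -[#|darts|]sum1_card.
rewrite (partition_big (fun d : G * G => [set d.1; d.2]) [in edges G]) /=;
  last first.
  by move=> d dd; apply: imset_f; rewrite inE.
rewrite mulnC -sum_nat_const; apply: leq_sum => e /imsetP[[a b] _ ->] /=.
rewrite sum1_card; apply: leq_trans (_ : #|[set (a, b); (b, a)]| <= 2).
  apply/subset_leq_card/subsetP => -[x y]; rewrite !inE /= => /andP[xy /eqP exy].
  have: x \in [set a; b] by rewrite -exy set21.
  have: y \in [set a; b] by rewrite -exy set22.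
  have: a \in [set x; y] by rewrite exy set21.
  have: b \in [set x; y] by rewrite exy set22.
  rewrite !inE -!pair_eqE /= ![_ == x]eq_sym ![_ == y]eq_sym.
  by do 4!case: eqP.
by rewrite cards2; case: eqP.
Qed.

(* The face to the side of the dart [d], which contains the corner at [d.2]
   between [d.1] and [(face_step d).2], is a triangle. *)
Definition triangular d := iter 3 face_step d == d.

Lemma triangular_step d : triangular (face_step d) = triangular d.
Proof. by rewrite /triangular -iterSr iterS (inj_eq face_step_inj). Qed.

Lemma num_faces_le (deg_ge2 : forall v, 1 < deg v) :
  12 * num_faces G + \sum_(d in darts) ~~ triangular d <= 4 * #|darts|.
Proof.
rewrite /num_faces [#|[set _ | _]|]eq_card0 ?addn0; last first.
  by move=> v; rewrite inE; have := deg_ge2 v; case: (deg v).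
have: 12 * fcard face_step darts <= \sum_(d in darts) (4 - ~~ triangular d).
  apply: fcard_leq_sum face_step_inj _ _ _ => [d _ /eqP<-|d|d dd].
  - exact/esym/face_step_dart.
  - by rewrite triangular_step.
  have [u_v v_w] : d.1 != d.2 /\ (face_step d).2 != d.1.
    split; first by apply: contraTneq dd => e; rewrite unfold_in /darts /= e adj_irr.
    apply: next_neq; rewrite ?rotation_uniq ?size_rotation //.
    by rewrite mem_rotation adj_sym.
  have := iter_order face_step_inj d; rewrite /triangular.
  case: order (order_gt0 face_step d) => [|[|[|[|n]]]] //= _.
  - by move=> e; move: u_v; rewrite -{1}e eqxx.
  - by move=> e; move: v_w; rewrite -{2}e eqxx.
  - by move->; rewrite eqxx.
  by case: eqP => _ _; lia.
have: \sum_(d in darts) (4 - ~~ triangular d) +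
    \sum_(d in darts) ~~ triangular d = 4 * #|darts|.
  rewrite -big_split mulnC -sum_nat_const; apply: eq_bigr => d _ /=; lia.
rewrite -[X in _ -> _ -> 12 * X + _ <= _]/(fcard face_step darts); lia.
Qed.

Lemma card_vertices_faces (v0 : G) (G_plane : plane G) :
  #|darts| < 2 * (#|G| + num_faces G).
Proof.
have C_gt0 : 0 < num_components G.
  rewrite /num_components; apply/card_gt0P; exists (root (@adj G) v0).
  rewrite inE /= andbT; apply: roots_root; apply: sym_connect_sym (@adj_sym G).
have := card_darts_edges; move: G_plane; rewrite /plane; lia.
Qed.


(* At most [40 (n - 6) / n], so that the charge [80 (n - 6)] of an [n]-vertex
   pays [2 * share n] for each of its [n] corners, and large enough for
   [share a + share b >= 40] when [a + b >= 25] and [10 <= a, b <= 15]. *)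
Definition share n :=
  nth 25 [:: 0; 0; 0; 0; 0; 0; 0; 0; 10; 13; 16; 18; 20; 20; 22; 24] n.

Lemma share16 n : 15 < n -> share n = 25.
Proof. by move=> n_gt15; rewrite /share nth_default. Qed.

Lemma share_le n : 4 < n -> share n * n + 240 <= 40 * n + 40 * (n == 5).
Proof.
case: (ltnP 15 n) => [n_gt15 _|]; first by rewrite share16 //; lia.
by move: n; do 16!case=> //.
Qed.

(* What a vertex of degree [b] sends to a neighbour of degree [a] inside a
   corner whose other side leads to a vertex of degree [c]. *)
Definition part a b c (t : bool) := (a == 5) * (share b * (1 + (t && (7 < c)))).

(* What a 5-vertex receives in the corner between neighbours of degrees [a] and
   [b] of a face that is ([t]) or is not a triangle. *)
Definition corner a b (t : bool) :=
  share a * (1 + (t && (7 < b))) + share b * (1 + (t && (7 < a))) + 40 * ~~ t.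

Definition received v :=
  \sum_(u <- rotation v)
    corner (deg u) (deg (next (rotation v) u)) (triangular (u, v)).

Lemma third_corner d : triangular d -> (face_step (face_step d)).2 = d.1.
Proof. by move/eqP=> {2}<-. Qed.

Lemma sum_received :
  \sum_(v : G | deg v == 5) received v <=
  \sum_(v : G) 2 * share (deg v) * deg v + 40 * \sum_(d in darts) ~~ triangular d.
Proof.
pose third d := (face_step d).2.
pose to_prev d := part (deg d.1) (deg d.2) (deg (third d)) (triangular d).
pose to_next d := part (deg (third d)) (deg d.2) (deg d.1) (triangular d).
have sum_step F : \sum_(d in darts) F (face_step d) = \sum_(d in darts) F d.
  rewrite [RHS](reindex_inj face_step_inj); apply: eq_bigl => d.
  exact/esym/face_step_dart.
have -> : \sum_(v : G) 2 * share (deg v) * deg v =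
    \sum_(d in darts) 2 * share (deg d.2).
  rewrite (sum_darts (fun _ v => 2 * share (deg v))); apply: eq_bigr => v _.
  by rewrite big_const_seq count_predT iter_addn_0 size_rotation.
have -> : \sum_(v : G | deg v == 5) received v = \sum_(d in darts)
    (deg d.2 == 5) * corner (deg d.1) (deg (third d)) (triangular d).
  pose F u v := (deg v == 5) * corner (deg u)
    (deg (next (rotation v) u)) (triangular (u, v)).
  transitivity (\sum_(d in darts) F d.1 d.2); last by apply: eq_bigr => -[].
  rewrite sum_darts big_mkcond; apply: eq_bigr => v _.
  by rewrite /F -big_distrr /= -/(received v); case: eqP; rewrite ?mul1n ?mul0n.
apply: (@leq_trans (\sum_(d in darts) (to_prev (face_step d) +
   part (deg d.2) (deg d.1) (deg (third d)) (triangular d) + 40 * ~~ triangular d))).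
  apply: leq_sum => d _; rewrite /to_prev triangular_step /third /part /corner /=.
  case: (boolP (triangular d)) => [/third_corner /= ->|_] /=;
    last by case: eqP => _; lia.
  by case: eqP => _; lia.
rewrite 2!big_split big_distrr /= sum_step leq_add2r.
rewrite -(sum_step (fun d => part (deg d.2) _ _ _)) -big_split /=.
apply: leq_sum => d _ /=.
have -> : part (deg (third d)) (deg d.2) (deg (third (face_step d)))
    (triangular (face_step d)) = to_next d.
  rewrite triangular_step /to_next /third.
  by case: (boolP (triangular d)) => [/third_corner /= ->|_].
by rewrite /to_prev /to_next /part; case: eqP => [->|_]; case: eqP => [->|_] /=; lia.
Qed.

Lemma sum_received_lt (v0 : G) (G_plane : plane G)
    (deg_ge5 : forall v, 4 < deg v) :
  \sum_(v : G | deg v == 5) received v < \sum_(v : G | deg v == 5) 80.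
Proof.
have shares : \sum_(v : G) share (deg v) * deg v + 240 * #|G| <=
    40 * #|darts| + 40 * \sum_(v : G) (deg v == 5).
  rewrite card_darts [240 * _]mulnC -sum_nat_const !big_distrr -!big_split /=.
  by apply: leq_sum => v _; apply: share_le.
have deg_ge2 v : 1 < deg v by apply: leq_trans (deg_ge5 v).
have := num_faces_le deg_ge2; have := card_vertices_faces v0 G_plane.
have := sum_received; move: shares.
have -> : \sum_(v : G | deg v == 5) 80 = 80 * \sum_(v : G) (deg v == 5).
  by rewrite big_distrr big_mkcond; apply: eq_bigr => v _; case: (_ == 5).
under [\sum_v 2 * _ * _]eq_bigr do rewrite -mulnA.
rewrite -big_distrr /=; lia.
Qed.

End Darts.

Lemma share5 : share 5 = 0.
Proof. by []. Qed.

Lemma share_cases n :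
  7 < n -> 15 < n /\ share n = 25 \/
           (n <= 15 /\ 2 * n <= share n + 6 /\ 10 <= share n <= 24).
Proof.
case: (ltnP 15 n) => [n_gt15 _|n_le15 n_gt7]; [left|right].
  by split=> //; apply: share16.
by move: n n_le15 n_gt7; do 16!case=> //.
Qed.

Lemma share_pair a b : 7 < a -> 7 < b -> [|| 15 < a, 15 < b | 24 < a + b] ->
  [\/ 40 <= share a + share b, a <= 9 /\ 15 < b | b <= 9 /\ 15 < a].
Proof.
move=> a_gt7 b_gt7; case: (ltnP 15 a) => [a_gt15 _|a_le15].
  rewrite (share16 a_gt15); case: (ltnP 9 b) => [b_gt9|]; last by constructor 3.
  constructor 1; case: (ltnP 15 b) => [/share16 -> //|].
  by move: b b_gt9 {b_gt7}; do 16!case=> //.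
case: (ltnP 15 b) => [b_gt15 _|b_le15 /= ab].
  rewrite (share16 b_gt15); case: (ltnP 9 a) => [a_gt9|]; last by constructor 2.
  by constructor 1; move: a a_gt9 a_le15 {a_gt7}; do 16!case=> //.
constructor 1; move: a b a_gt7 b_gt7 a_le15 b_le15 ab.
by do 16![case=> //]; do 16!case=> //.
Qed.

Lemma corner_ge a b t : share a + share b + 40 * ~~ t <= corner a b t.
Proof. by rewrite /corner; lia. Qed.

Definition admissible (s : seq nat) :=
  [&& all (fun n => (n == 5) || (7 < n)) s, 1 < count (leq 8) s
    & has (leq 16) s || (39 < sumn s)].

Definition big_adjacent a b c d e :=
  [|| (7 < a) && (7 < b), (7 < b) && (7 < c), (7 < c) && (7 < d),
      (7 < d) && (7 < e) | (7 < e) && (7 < a)].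

Lemma corner_sum a b c d e t0 t1 t2 t3 t4 :
    let s := [:: a; b; c; d; e] in
    let sh := share a + share b + share c + share d + share e in
    let r := corner a b t0 + corner b c t1 + corner c d t2 + corner d e t3 +
             corner e a t4 in
    admissible s ->
  110 <= r \/ [&& t0, t1, t2, t3 & t4] /\
  [\/ 2 < count (leq 8) s /\ 100 <= r,
      [/\ count (leq 8) s = 2, big_adjacent a b c d e & 105 <= r]
    | [/\ count (leq 8) s = 2, ~~ big_adjacent a b c d e, r = 2 * sh & 35 <= sh]].
Proof.
move=> s sh r adm; have sh_ge35 : 35 <= sh.
  move: adm; rewrite /admissible {}/sh {}/s {r}.
  case/and3P=> /and5P[+ + + + /andP[+ _]].
  do 5!case/orP=> [/eqP->|?] //=; rewrite ?share5 => big_ge2 heavy;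
    repeat match goal with H : is_true (7 < ?x) |- _ =>
         move: (share_cases H); move: H (share x) end; lia.
have r_ge : 2 * sh + 40 * (~~ t0 + ~~ t1 + ~~ t2 + ~~ t3 + ~~ t4) <= r.
  rewrite /r /sh; have := corner_ge a b t0; have := corner_ge b c t1.
  have := corner_ge c d t2; have := corner_ge d e t3; have := corner_ge e a t4.
  by lia.
case: (boolP [&& t0, t1, t2, t3 & t4]) => [/and5P[]|]; last by left; lia.
move: r_ge; rewrite {}/r; case: t0 => //; case: t1 => //; case: t2 => //.
case: t3 => //; case: t4 => //= r_ge _ _ _ _ _; right; split=> //.
move: adm r_ge sh_ge35; rewrite /admissible {}/sh {}/s.
case/and3P=> /and5P[+ + + + /andP[+ _]].
do 5!case/orP=> [/eqP->|?] //=; rewrite /corner /big_adjacent ?share5;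
  repeat match goal with H : is_true (7 < ?x) |- _ =>
    rewrite ?H /=; move: (share_cases H); move: H (share x) end; rewrite /=;
  move=> *; try (constructor 3; split; lia); try (constructor 2; split; lia);
  constructor 1; split; lia.
Qed.

Section Neighbourhoods.
Variable G : embedded_graph.
Implicit Types u v w x y z : G.

Definition listing v s := exists i, rot i (rotation v) = s.

Definition around v := [seq deg u | u <- rotation v].

Definition needy v := (deg v == 5) && (received v < 80).
Definition rich v := (deg v == 5) && (99 < received v).

Lemma listing_from v u : deg v = 5 -> adj v u ->
  exists x1 x2 x3 x4, listing v [:: u; x1; x2; x3; x4].
Proof.
move=> v5 vu; have /rot_to[i s def_s] : u \in rotation v by rewrite mem_rotation.
have : size (u :: s) = 5 by rewrite -def_s size_rot size_rotation.
case: s def_s => [|x1 [|x2 [|x3 [|x4 []]]]] //= def_s _.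
by exists x1, x2, x3, x4, i.
Qed.

Lemma deg5_neighbour v : deg v = 5 -> exists u, adj v u.
Proof.
move=> v5; have : 0 < deg v by rewrite v5.
by case/card_gt0P=> u; rewrite inE; exists u.
Qed.

Lemma listing_rot v s n : listing v s -> listing v (rot n s).
Proof.
case=> i <-; have [le_n|lt_n] := leqP n (size (rotation v)); last first.
  by rewrite rot_oversize ?size_rot 1?ltnW //; exists i.
have [le_i|lt_i] := leqP i (size (rotation v)).
  by rewrite rot_add_mod //; eexists.
by rewrite [rot i _]rot_oversize 1?ltnW //; exists n.
Qed.

Lemma listing_adj v s u : listing v s -> (u \in s) = adj v u.
Proof. by case=> i <-; rewrite mem_rot mem_rotation. Qed.

Lemma listing_sum v s (F : G -> nat) :
  listing v s -> \sum_(u <- rotation v) F u = \sum_(u <- s) F u.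
Proof. by case=> i <-; apply: perm_big; rewrite perm_sym perm_rot. Qed.

Lemma listing_next v x0 x1 x2 x3 x4 : listing v [:: x0; x1; x2; x3; x4] ->
  let nx := next (rotation v) in
  [/\ nx x0 = x1, nx x1 = x2, nx x2 = x3, nx x3 = x4 & nx x4 = x0].
Proof.
case=> i def_s; have := cycle_next (rotation_uniq v).
rewrite -(rot_cycle i) def_s /=.
by case/and5P=> /eqP-> /eqP-> /eqP-> /eqP-> /andP[/eqP-> _].
Qed.

Lemma triangle_next v u w : next (rotation v) u = w -> triangular (u, v) ->
  next (rotation w) v = u /\ next (rotation u) w = v.
Proof.
by move=> <-; rewrite /triangular /face_step /= xpair_eqE => /andP[/eqP-> /eqP].
Qed.

Hypothesis deg5_admissible : forall v, deg v = 5 -> admissible (around v).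

Lemma listing_admissible v s :
  deg v = 5 -> listing v s -> admissible [seq deg u | u <- s].
Proof.
move/deg5_admissible=> + [i <-]; rewrite /admissible /around.
have p : perm_eq (rot i (rotation v)) (rotation v) by rewrite perm_rot.
have {}p := perm_map (fun u => deg u) p.
by rewrite (perm_all _ p) (perm_has _ p) (permP p) (perm_sumn p).
Qed.

Lemma received_listing v x0 x1 x2 x3 x4 : listing v [:: x0; x1; x2; x3; x4] ->
  received v =
  corner (deg x0) (deg x1) (triangular (x0, v)) +
  corner (deg x1) (deg x2) (triangular (x1, v)) +
  corner (deg x2) (deg x3) (triangular (x2, v)) +
  corner (deg x3) (deg x4) (triangular (x3, v)) +
  corner (deg x4) (deg x0) (triangular (x4, v)).
Proof.
move=> vL; have [e0 e1 e2 e3 e4] := listing_next vL.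
rewrite /received (listing_sum _ vL) 5!big_cons big_nil.
by rewrite e0 e1 e2 e3 e4; lia.
Qed.

Definition all_triangular v := [forall u, adj v u ==> triangular (u, v)].

Lemma all_triangular_listing v x0 x1 x2 x3 x4 :
  listing v [:: x0; x1; x2; x3; x4] ->
  [&& triangular (x0, v), triangular (x1, v), triangular (x2, v),
      triangular (x3, v) & triangular (x4, v)] = all_triangular v.
Proof.
move=> vL; apply/idP/forallP=> [/and5P[t0 t1 t2 t3 t4] u|tri].
  by apply/implyP; rewrite -(listing_adj _ vL) !inE => /or4P[|||/orP[]] /eqP->.
by apply/and5P; split; apply: (implyP (tri _));
  rewrite -(listing_adj _ vL) !inE eqxx ?orbT.
Qed.

Lemma received_cases v x0 x1 x2 x3 x4 :
    deg v = 5 -> listing v [:: x0; x1; x2; x3; x4] ->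
    let s := [:: deg x0; deg x1; deg x2; deg x3; deg x4] in
    let sh := share (deg x0) + share (deg x1) + share (deg x2) +
              share (deg x3) + share (deg x4) in
    let adjacent := big_adjacent (deg x0) (deg x1) (deg x2) (deg x3) (deg x4) in
  110 <= received v \/ all_triangular v /\
  [\/ 2 < count (leq 8) s /\ 100 <= received v,
      [/\ count (leq 8) s = 2, adjacent & 105 <= received v]
    | [/\ count (leq 8) s = 2, ~~ adjacent, received v = 2 * sh & 35 <= sh]].
Proof.
move=> v5 vL; rewrite /= (received_listing vL) -(all_triangular_listing vL).
exact: corner_sum (listing_admissible v5 vL).
Qed.

Lemma not_rich v x0 x1 x2 x3 x4 :
    deg v = 5 -> listing v [:: x0; x1; x2; x3; x4] -> ~~ rich v ->
  [/\ all_triangular v,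
      count (leq 8) [:: deg x0; deg x1; deg x2; deg x3; deg x4] = 2,
      ~~ big_adjacent (deg x0) (deg x1) (deg x2) (deg x3) (deg x4)
    & share (deg x0) + share (deg x1) + share (deg x2) + share (deg x3) +
      share (deg x4) < 50].
Proof.
move=> v5 vL; rewrite /rich v5 /= => poor.
by case: (received_cases v5 vL) => [|[tri [[]|[]|[]]]]; try lia; split=> //; lia.
Qed.

Lemma needy_not_rich v : needy v -> ~~ rich v.
Proof. by rewrite /needy /rich; case: eqP => //=; lia. Qed.

Lemma needy_listing v : needy v -> exists x a y b c,
  [/\ listing v [:: x; a; y; b; c], all_triangular v, deg b = 5,
     deg c = 5 & 7 < deg x <= 9 /\ 15 < deg y \/ 7 < deg y <= 9 /\ 15 < deg x].
Proof.
move=> v_needy; have poor := needy_not_rich v_needy.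
case/andP: v_needy => /eqP v5 v80.
have [u vu] := deg5_neighbour v5.
have [x1 [x2 [x3 [x4 vL]]]] := listing_from v5 vu.
have [tri big2 nadj _] := not_rich v5 vL poor.
have sh : share (deg u) + share (deg x1) + share (deg x2) + share (deg x3) +
      share (deg x4) < 40.
  by case: (received_cases v5 vL) => [|[_ [[]|[]|[]]]]; try lia.
have pair x a y b c :
    deg a = 5 -> deg b = 5 -> deg c = 5 -> 7 < deg x -> 7 < deg y ->
    share (deg x) + share (deg y) < 40 ->
    [|| 15 < deg x, 15 < deg y | 24 < deg x + deg y] ->
    listing v [:: x; a; y; b; c] -> exists x a y b c,
  [/\ listing v [:: x; a; y; b; c], all_triangular v, deg b = 5,
     deg c = 5 & 7 < deg x <= 9 /\ 15 < deg y \/ 7 < deg y <= 9 /\ 15 < deg x].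
  move=> a5 b5 c5 x7 y7 xy40 xy vL'; exists x, a, y, b, c; split=> //.
  by have [] := share_pair x7 y7 xy; lia.
have /and3P[/and5P[o0 o1 o2 o3 /andP[o4 _]] _ heavy] := listing_admissible v5 vL.
move: nadj big2 sh heavy; rewrite /big_adjacent.
case/orP: o0 => /= [/eqP e0|e0]; case/orP: o1 => /= [/eqP e1|e1];
  case/orP: o2 => /= [/eqP e2|e2]; case/orP: o3 => /= [/eqP e3|e3];
  case/orP: o4 => /= [/eqP e4|e4];
  rewrite ?e0 ?e1 ?e2 ?e3 ?e4 //= ?share5 => _ _ sh heavy.
- by apply: (pair _ _ _ _ _ _ _ _ _ _ _ _ (listing_rot 2 vL)) => //; lia.
- by apply: (pair _ _ _ _ _ _ _ _ _ _ _ _ (listing_rot 4 vL)) => //; lia.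
- by apply: (pair _ _ _ _ _ _ _ _ _ _ _ _ (listing_rot 1 vL)) => //; lia.
- by apply: (pair _ _ _ _ _ _ _ _ _ _ _ _ (listing_rot 3 vL)) => //; lia.
- by apply: (pair _ _ _ _ _ _ _ _ _ _ _ _ vL) => //; lia.
Qed.

Lemma needy_deficit v : deg v = 5 -> 80 <= received v + 10 * needy v.
Proof.
move=> v5; rewrite /needy v5 eqxx /=.
case: (ltnP (received v) 80) => [lt80|]; last by lia.
have [u vu] := deg5_neighbour v5.
have [x1 [x2 [x3 [x4 vL]]]] := listing_from v5 vu.
by case: (received_cases v5 vL) => [|[_ [[]|[]|[]]]]; lia.
Qed.

Lemma needy_rich v : needy v -> exists2 u, adj v u & rich u.
Proof.
move=> v_needy; have [x [a [y [b [c [vL tri b5 c5 xy]]]]]] := needy_listing v_needy.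
have {v_needy} v5 : deg v = 5 by case/andP: v_needy => /eqP.
have triv u : adj v u -> triangular (u, v) by move/forallP: tri => /(_ u)/implyP.
have vb : adj v b by rewrite -(listing_adj _ vL) !inE eqxx ?orbT.
have vc : adj v c by rewrite -(listing_adj _ vL) !inE eqxx ?orbT.
have vx : adj v x by rewrite -(listing_adj _ vL) !inE eqxx ?orbT.
have vy : adj v y by rewrite -(listing_adj _ vL) !inE eqxx ?orbT.
have [b_rich|b_poor] := boolP (rich b); first by exists b.
have [c_rich|c_poor] := boolP (rich c); first by exists c.
have [_ _ nyb nbc ncx] := listing_next vL.
have [nbv _] := triangle_next nyb (triv _ vy).
have [ncv nbv'] := triangle_next nbc (triv _ vb).
have [_ nxv] := triangle_next ncx (triv _ vc).
have adj_next w u u' : next (rotation w) u = u' -> adj w u = adj w u'.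
  by move=> <-; rewrite -!mem_rotation mem_next.
have bv : adj b v by rewrite adj_sym.
have cv : adj c v by rewrite adj_sym.
have [b1 [b2 [s [t bL]]]] := listing_from b5 (etrans (adj_next _ _ _ nbv') bv).
have [e1 e2 _ _ ntc] := listing_next bL.
move: bL; rewrite -e2 -e1 nbv' nbv => bL {b1 b2 e1 e2}.
have [c1 [c2 [t' [r cL]]]] := listing_from c5 (etrans (adj_next _ _ _ nxv) cv).
have [e1 e2 e3 _ _] := listing_next cL.
move: cL; rewrite -e3 -e2 -e1 nxv ncv => cL {c1 c2 t' e1 e2 e3}.
have [trib bigb nadjb shb] := not_rich b5 bL b_poor.
have [_ bigc nadjc shc] := not_rich c5 cL c_poor.
have bt : adj b t by rewrite -(listing_adj _ bL) !inE eqxx ?orbT.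
have [nct _] := triangle_next ntc (implyP (forallP trib t) bt).
rewrite nct in cL bigc nadjc shc.
have /and3P[/and5P[_ _ _ os _] _ heavyb] := listing_admissible b5 bL.
have /and3P[/and5P[_ _ _ _ /andP[or _]] _ heavyc] := listing_admissible c5 cL.
have [x7 y7] : 7 < deg x /\ 7 < deg y by clear -xy; lia.
move: bigb nadjb shb bigc nadjc shc heavyb heavyc os or.
rewrite /big_adjacent /= v5 b5 c5 x7 y7 share5 /=.
case: (ltnP 7 (deg s)) => //= _ t_big _ shb r_big _ shc heavyb heavyc.
have t7 : 7 < deg t by clear -t_big; lia.
rewrite t7 /= in r_big; rewrite orbF => /eqP s5.
have r7 : (7 < deg r) = false by clear -r_big; lia.
rewrite r7 orbF => /eqP r5.
have t_gt15 : 15 < deg t.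
  move: heavyb heavyc; rewrite s5 r5 /= !orbF; clear -xy; case: xy; lia.
exfalso; case: xy => -[_ /share16 big_share].
  by move: shb; rewrite big_share (share16 t_gt15); clear; lia.
by move: shc; rewrite big_share (share16 t_gt15); clear; lia.
Qed.

Lemma needy_between v x y z :
    next (rotation v) x = y -> next (rotation v) y = z -> adj v x ->
    triangular (x, v) -> triangular (y, v) -> needy y ->
  ~ [/\ deg v = 5, deg x = 5 & deg z = 5] /\ ~ (15 < deg x /\ 15 < deg z).
Proof.
move=> nxy nyz vx trix triy y_needy.
have [nyv _] := triangle_next nxy trix; have [_ nyz'] := triangle_next nyz triy.
have y5 : deg y = 5 by case/andP: y_needy => /eqP.
have yv : adj y v by rewrite adj_sym -mem_rotation -nxy mem_next mem_rotation.
have yz : adj y z by rewrite -mem_rotation -mem_next nyz' mem_rotation.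
have [x1 [x2 [p [q yL]]]] := listing_from y5 yz.
have [e1 e2 _ _ _] := listing_next yL.
move: yL; rewrite -e2 -e1 nyz' nyv => yL {x1 x2 e1 e2}.
have [_ big2 nadj sh] := not_rich y5 yL (needy_not_rich y_needy).
split=> [[v5 x5 z5]|[/share16 xs /share16 zs]].
  by move: big2 nadj; rewrite /big_adjacent /= v5 x5 z5; lia.
by rewrite xs zs in sh; lia.
Qed.

Lemma rich_bound v :
  rich v -> 80 + 10 * \sum_(u <- rotation v) needy u <= received v.
Proof.
move=> v_rich; have [v5 v100] : deg v = 5 /\ 100 <= received v.
  by case/andP: v_rich => /eqP.
have [u vu] := deg5_neighbour v5.
have [x1 [x2 [x3 [x4 vL]]]] := listing_from v5 vu.
rewrite (listing_sum _ vL) 5!big_cons big_nil.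
have needy5 w : needy w + (7 < deg w) <= 1.
  by rewrite /needy; case: eqP => [->|_] /=; [rewrite addn0|]; apply: leq_b1.
have few : needy u + (needy x1 + (needy x2 + (needy x3 + (needy x4 + 0)))) +
    count (leq 8) [:: deg u; deg x1; deg x2; deg x3; deg x4] <= 5.
  have := conj (needy5 u) (conj (needy5 x1) (conj (needy5 x2)
    (conj (needy5 x3) (needy5 x4)))).
  by rewrite /=; lia.
have /and3P[/and5P[o0 o1 o2 o3 /andP[o4 _]] big_ge2 _] := listing_admissible v5 vL.
have [r110|[tri cases]] := received_cases v5 vL.
  by move: few big_ge2 r110 => /=; clear; lia.
have [n0 n1 n2 n3 n4] := listing_next vL.
have between x y z : next (rotation v) x = y -> next (rotation v) y = z ->
    adj v x -> needy y ->
  ~ (deg x = 5 /\ deg z = 5) /\ ~ (15 < deg x /\ 15 < deg z).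
  move=> nxy nyz vx y_needy; have triv w : adj v w -> triangular (w, v).
    by move/forallP: tri => /(_ w)/implyP.
  have vy : adj v y by rewrite -mem_rotation -nxy mem_next mem_rotation.
  have [no5 no16] := needy_between nxy nyz vx (triv x vx) (triv y vy) y_needy.
  by split=> // -[x5 z5]; apply: no5.
have [v1 v2 v3 v4] : [/\ adj v x1, adj v x2, adj v x3 & adj v x4].
  by split; rewrite -(listing_adj _ vL) !inE eqxx ?orbT.
move: (between _ _ _ n4 n0 v4) (between _ _ _ n0 n1 vu) (between _ _ _ n1 n2 v1).
move: (between _ _ _ n2 n3 v2) (between _ _ _ n3 n4 v3).
case: cases => [[big3 _]|[big2 adj5 v105]|[big2 nadj rE _]].
- by move=> _ _ _ _ _; move: few v100 big3 => /=; clear; lia.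
- move: v105 big2 adj5 (needy5 u) (needy5 x1) (needy5 x2) (needy5 x3) (needy5 x4).
  clear -o0 o1 o2 o3 o4; rewrite /big_adjacent.
  case/orP: o0 => /= [/eqP e0|e0]; case/orP: o1 => /= [/eqP e1|e1];
    case/orP: o2 => /= [/eqP e2|e2]; case/orP: o3 => /= [/eqP e3|e3];
    case/orP: o4 => /= [/eqP e4|e4]; rewrite ?e0 ?e1 ?e2 ?e3 ?e4 //= => + _ _; lia.
move: v100 rE big2 nadj (needy5 u) (needy5 x1) (needy5 x2) (needy5 x3) (needy5 x4).
clear -o0 o1 o2 o3 o4; rewrite /big_adjacent.
case/orP: o0 => /= [/eqP e0|e0]; case/orP: o1 => /= [/eqP e1|e1];
  case/orP: o2 => /= [/eqP e2|e2]; case/orP: o3 => /= [/eqP e3|e3];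
  case/orP: o4 => /= [/eqP e4|e4];
  rewrite ?e0 ?e1 ?e2 ?e3 ?e4 //= ?share5 => r100 rE _ _;
  move: r100 rE; repeat match goal with H : is_true (7 < deg ?w) |- _ =>
    move: (share_cases H); move: {H} (share (deg w)) end; lia.
Qed.

Lemma neighbourhoods_balance :
  \sum_(v : G | deg v == 5) 80 <= \sum_(v : G | deg v == 5) received v.
Proof.
have bound v : deg v == 5 ->
    80 + 10 * (rich v * \sum_(u <- rotation v) needy u) <=
    received v + 10 * needy v.
  move/eqP=> v5; case: (boolP (rich v)) => [v_rich|_].
    by rewrite mul1n; apply: leq_trans (rich_bound v_rich) (leq_addr _ _).
  by rewrite mul0n addn0; apply: needy_deficit.
have := leq_sum (index_enum G) bound.
rewrite [leqLHS]big_split [leqRHS]big_split /= -!big_distrr /=.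
have : \sum_(v : G | deg v == 5) needy v <=
    \sum_(v : G | deg v == 5) rich v * \sum_(u <- rotation v) needy u; last by lia.
have -> : \sum_(v : G | deg v == 5) rich v * (\sum_(u <- rotation v) needy u) =
    \sum_(u : G) needy u * \sum_(v : G) (rich v && adj u v).
  under [RHS]eq_bigr do rewrite big_distrr /=.
  rewrite exchange_big /= big_mkcond; apply: eq_bigr => v _.
  rewrite (big_uniq _ (rotation_uniq v)) /= big_mkcond big_distrr /=.
  case: ifP => [_|v5].
    apply: eq_bigr => u _; rewrite mem_rotation adj_sym.
    by case: (rich v) (adj u v) (needy u) => [] [] [].
  by rewrite big1 // => u _; rewrite /rich v5 muln0.
rewrite big_mkcond; apply: leq_sum => u _; case: ifP => // _.
case: (boolP (needy u)) => // /needy_rich[v uv v_rich].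
by rewrite mul1n (bigD1 v) //= v_rich uv.
Qed.

End Neighbourhoods.

Section HeavyStars.
Variable G : embedded_graph.
Implicit Types u v w : G.

Lemma weight_star v :
  weight (v |: neighbours v) = deg v + \sum_(u <- rotation v) deg u.
Proof.
rewrite /weight big_setU1 /=; last by rewrite inE adj_irr.
rewrite big_uniq ?rotation_uniq //=; congr (_ + _).
by apply: eq_bigl => u; rewrite inE mem_rotation.
Qed.

Lemma height_star v n :
  (height (v |: neighbours v) <= n) =
  (deg v <= n) && all (fun u => deg u <= n) (rotation v).
Proof.
apply/bigmax_leqP/andP=> [le_n|[le_v /allP le_n] u].
  split; first by apply: le_n; rewrite setU11.
  by apply/allP => u; rewrite mem_rotation => vu; apply: le_n; rewrite !inE vu orbT.
by rewrite !inE => /predU1P[->//|vu]; apply: le_n; rewrite mem_rotation.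
Qed.

Lemma rotation_admissible v :
    (forall u, 4 < deg u) -> (forall u, deg u <> 6) -> (forall u, deg u <> 7) ->
    ~ has_star G (Some 5) (Some 5) (Some 5) (Some 5) None ->
    ~ (weight (v |: neighbours v) <= 44 /\ height (v |: neighbours v) <= 15) ->
  deg v = 5 -> admissible (around v).
Proof.
move=> deg_ge5 deg6 deg7 no_star heavy v5.
have deg_cases u : (deg u == 5) || (7 < deg u).
  by have := deg_ge5 u; have := deg6 u; have := deg7 u; lia.
apply/and3P; split; first by apply/allP => _ /mapP[u _ ->]; apply: deg_cases.
  rewrite ltnNge; apply/negP => big_le1; apply: no_star.
  have := size_rotation v; rewrite v5.
  case def_r: (rotation v) => [|x0 [|x1 [|x2 [|x3 [|x4 []]]]]] //= _.
  have star n y0 y1 y2 y3 y4 : rot n (rotation v) = [:: y0; y1; y2; y3; y4] ->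
      deg y0 = 5 -> deg y1 = 5 -> deg y2 = 5 -> deg y3 = 5 ->
      has_star G (Some 5) (Some 5) (Some 5) (Some 5) None.
    move=> def_s d0 d1 d2 d3; exists v, y0, y1, y2, y3, y4; split=> //.
      by exists n; left.
    by rewrite /le_bound d0 d1 d2 d3.
  move: big_le1; rewrite /around def_r /=.
  have := deg_cases x0; have := deg_cases x1; have := deg_cases x2.
  have := deg_cases x3; have := deg_cases x4.
  rewrite def_r in star.
  case/orP=> [/eqP e4|e4]; case/orP=> [/eqP e3|e3];
    case/orP=> [/eqP e2|e2]; case/orP=> [/eqP e1|e1]; case/orP=> [/eqP e0|e0];
    rewrite ?e0 ?e1 ?e2 ?e3 ?e4 // => _.
  - exact: (star 0).
  - exact: (star 1).
  - exact: (star 2).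
  - exact: (star 3).
  - exact: (star 4).
  - exact: (star 0).
case: (boolP (has _ _)) => //= /hasPn small; rewrite ltnNge; apply/negP => light.
apply: heavy; rewrite weight_star height_star v5; split.
  by move: light; rewrite /around sumnE big_map; lia.
by apply/allP => u ru /=; rewrite leqNgt; apply: small; apply: map_f.
Qed.

End HeavyStars.

Theorem theorem15 (G : embedded_graph) (hplane : plane G)
    (hmin : min_degree_is G 5)
    (hstar : ~ has_star G (Some 5) (Some 5) (Some 5) (Some 5) None)
    (h6 : forall v : G, deg v <> 6)
    (h7 : forall v : G, deg v <> 7) :
  exists A : {set G},
    [/\ minor_5star A, weight A <= 44 & height A <= 15].
Proof.
have [[v0 v05] deg_ge5] := hmin.
case: (boolP [exists v : G, [&& deg v == 5, weight (v |: neighbours v) <= 44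
    & height (v |: neighbours v) <= 15]]) => [/existsP[v /and3P[/eqP v5 ? ?]]|].
  by exists (v |: neighbours v); split=> //; exists v.
move/existsPn => no_light; have := sum_received_lt v0 hplane deg_ge5.
rewrite ltnNge neighbourhoods_balance // => v v5.
apply: rotation_admissible => // -[wt ht].
by have := no_light v; rewrite v5 wt ht.
Qed.
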